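(* Let $L_0,v_0,w_{m_0}$ be positive constants with $v_0>w_{m_0}$. There exists a unique similarity type solution $(w,s)$ to the problem $$w_{zz}=w_t,\quad 0<z<s(t),\ t>0;\qquad w_z(s(t),t)=-L_0\sqrt t\,s'(t),\quad t>0;$$ $$w(s(t),t)=2w_{m_0}\sqrt t,\quad t>0;\qquad w(0,t)=2v_0\sqrt t,\quad t>0;\qquad s(0)=0,$$ and it is given by $$w(z,t)=2v_0\sqrt t\,\exp\left(-\frac{z^2}{4t}\right)+v_0z\sqrt\pi\,\mathrm{erf}\left(\frac{z}{2\sqrt t}\right)-L_0z\gamma^*-v_0z\sqrt\pi\,\mathrm{erf}(\gamma^* ),\qquad 0\le z\le s(t),\ t>0,$$ $$s(t)=2\gamma^*\sqrt t,\qquad t>0,$$ where $\gamma^*$ is the unique solution to the equation $$v_0\exp(-\gamma^2)=L_0\gamma^2+w_{m_0},\qquad \gamma>0.$$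
   Context: $\mathrm{erf}(x)=\frac{2}{\sqrt\pi}\int_0^x e^{-u^2}\,du$. A similarity type solution is a solution $(w,s)$ of the form $w(z,t)=2\sqrt t\,T(\eta)$ with $\eta=\frac{z}{2\sqrt t}$ for some function $T$ of one variable, and $s(t)=2\gamma\sqrt t$ for some constant $\gamma>0$. A pair $(w,s)$ is a solution if $w,w_z,w_t,w_{zz}$ are continuous in $\{(z,t):0<z<s(t),\ t>0\}$ and all the conditions of the problem are satisfied.
   Formalization: A solution is additionally required to have w continuous up to the boundary, on 0≤z≤s(t), t>0; with continuity only in 0<z<s(t), the value w(0,t) is unrelated to the interior and uniqueness fails. *)

(* Defs.v *)
From Stdlib Require Export Reals.
From Coquelicot Require Export Coquelicot.
Global Open Scope R_scope.

Definition erf (x : R) : R :=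
  2 / sqrt PI * RInt (fun u => exp (- (u ^ 2))) 0 x.

(* Functions [w : R -> R -> R] are written [w z t] (space, then time); only the
   values of [w] for [0 <= z <= s t], [0 < t], and those of [s] for [0 <= t],
   are relevant. *)

Definition open_region (s : R -> R) (p : R * R) : Prop :=
  0 < snd p /\ 0 < fst p < s (snd p).

Definition closed_region (s : R -> R) (p : R * R) : Prop :=
  0 < snd p /\ 0 <= fst p <= s (snd p).

Definition w_z (w : R -> R -> R) (z t : R) : R := Derive (fun y => w y t) z.
Definition w_t (w : R -> R -> R) (z t : R) : R := Derive (fun r => w z r) t.
Definition w_zz (w : R -> R -> R) (z t : R) : R := Derive_n (fun y => w y t) 2 z.

(* [Derive] is total, so the existence of the derivatives is required
   separately. *)
Definition regular_in (s : R -> R) (w : R -> R -> R) : Prop :=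
  (forall z t : R, open_region s (z, t) ->
     ex_derive (fun y => w y t) z /\
     ex_derive_n (fun y => w y t) 2 z /\
     ex_derive (fun r => w z r) t) /\
  continuous_on (open_region s) (fun p : R * R => w (fst p) (snd p)) /\
  continuous_on (open_region s) (fun p : R * R => w_z w (fst p) (snd p)) /\
  continuous_on (open_region s) (fun p : R * R => w_t w (fst p) (snd p)) /\
  continuous_on (open_region s) (fun p : R * R => w_zz w (fst p) (snd p)).

(* The value of the space derivative at the free boundary: [w] is only given on
   the side [z <= x], so this is a left derivative. *)
Definition is_left_derive (f : R -> R) (x l : R) : Prop :=
  filterlim (fun y => (f y - f x) / (y - x)) (at_left x) (locally l).

Definition is_solution (L0 v0 wm0 : R) (w : R -> R -> R) (s : R -> R) : Prop :=
  regular_in s w /\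
  (* Ties the boundary values to the values inside the region; without it
     [w 0 t] would be an arbitrary number unrelated to the rest of [w]. *)
  continuous_on (closed_region s) (fun p : R * R => w (fst p) (snd p)) /\
  (forall z t : R, open_region s (z, t) -> w_zz w z t = w_t w z t) /\
  (forall t : R, 0 < t ->
     ex_derive s t /\
     is_left_derive (fun y => w y t) (s t) (- L0 * sqrt t * Derive s t)) /\
  (forall t : R, 0 < t -> w (s t) t = 2 * wm0 * sqrt t) /\
  (forall t : R, 0 < t -> w 0 t = 2 * v0 * sqrt t) /\
  s 0 = 0.

Definition similarity_type (w : R -> R -> R) (s : R -> R) : Prop :=
  exists (T : R -> R) (gamma : R),
    0 < gamma /\
    (forall t : R, 0 < t -> s t = 2 * gamma * sqrt t) /\
    (forall z t : R, closed_region s (z, t) ->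
       w z t = 2 * sqrt t * T (z / (2 * sqrt t))).

Definition is_similarity_solution (L0 v0 wm0 : R)
    (w : R -> R -> R) (s : R -> R) : Prop :=
  is_solution L0 v0 wm0 w s /\ similarity_type w s.

(* Equality of pairs (w, s), as functions on their actual domains. *)
Definition same_pair (w1 : R -> R -> R) (s1 : R -> R)
    (w2 : R -> R -> R) (s2 : R -> R) : Prop :=
  (forall t : R, 0 <= t -> s1 t = s2 t) /\
  (forall z t : R, closed_region s1 (z, t) -> w1 z t = w2 z t).

(* Main.v *)
(** With [w(z,t) = 2 sqrt t T(z/(2 sqrt t))] the heat equation becomes
    [T'' = 2 (T - x T')].  The quantity [u = T - x T'] satisfies [u' = - 2 x u],
    so [u = a exp(-x^2)]; subtracting the particular solution
    [a (exp(-x^2) + sqrt PI x erf x)] leaves [G] with [(G/x)' = 0].  Hence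
    [T = a (exp(-x^2) + sqrt PI x erf x) + b x]: the condition at [z = 0] fixes
    [a = v0], the flux condition at [z = s t] fixes [b] in terms of [gamma], and
    the remaining condition at [z = s t] is the equation for [gamma], whose two
    sides are respectively strictly decreasing and strictly increasing. *)

Require Import Defs.
From Stdlib Require Import Lra.

(** * The error function and the two-parameter family of profiles *)

Lemma is_derive_erf (x : R) :
  is_derive erf x (2 / sqrt PI * exp (- (x ^ 2))).
Proof.
unfold erf.
apply (is_derive_scal (fun y => RInt (fun u => exp (- (u ^ 2))) 0 y)).
assert (C : forall y, continuous (fun u => exp (- (u ^ 2))) y).
{ intros y; apply (ex_derive_continuous (fun u => exp (- (u ^ 2)))).
  auto_derive; auto. }
apply (is_derive_RInt (fun u => exp (- (u ^ 2))) _ 0); [ | apply C].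
apply filter_forall; intros y.
apply (RInt_correct (V := R_CompleteNormedModule)).
apply (ex_RInt_continuous (V := R_CompleteNormedModule) (fun u => exp (- (u ^ 2)))); intros; apply C.
Qed.

Lemma sqrt_PI_pos : 0 < sqrt PI.
Proof. apply sqrt_lt_R0, PI_RGT_0. Qed.

(** General solution of [T'' = 2 (T - x T')]: [a] is the value at the origin and [b] the slope
    there. *)
Definition profile (a b x : R) : R :=
  a * (exp (- (x ^ 2)) + sqrt PI * x * erf x) + b * x.

Lemma profile_0 (a b : R) : profile a b 0 = a.
Proof.
unfold profile; replace (- 0 ^ 2) with 0 by ring; rewrite exp_0; ring.
Qed.

(** The derivative of the exponential cancels [sqrt PI * x] times the derivative of [erf], so only
    the error function and a constant remain. *)
Lemma is_derive_profile (a b x : R) :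
  is_derive (profile a b) x (a * sqrt PI * erf x + b).
Proof.
unfold profile; auto_derive.
- exists (2 / sqrt PI * exp (- (x ^ 2))); apply is_derive_erf.
- rewrite (is_derive_unique (fun x0 : R => erf x0) _ _ (is_derive_erf x)).
  pose proof sqrt_PI_pos; replace (x * (x * 1)) with (x ^ 2) by ring; field; lra.
Qed.

Lemma is_derive_profile' (a b x : R) :
  is_derive (fun y => a * sqrt PI * erf y + b) x (2 * a * exp (- (x ^ 2))).
Proof.
auto_derive.
- exists (2 / sqrt PI * exp (- (x ^ 2))); apply is_derive_erf.
- rewrite (is_derive_unique (fun x0 : R => erf x0) _ _ (is_derive_erf x)).
  pose proof sqrt_PI_pos; field; lra.
Qed.

(** * The ordinary differential equation for similarity profiles *)

Lemma constant_of_zero_derive (f : R -> R) (a b : R) :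
  (forall x, a < x < b -> is_derive f x 0) ->
  forall x y, a < x < b -> a < y < b -> f x = f y.
Proof.
intros H x y Hx Hy.
destruct (Rtotal_order x y) as [L | [-> | L]]; [ | easy | symmetry];
  apply eq_is_derive; try easy; intros t Ht; apply H; lra.
Qed.

(** The equation is assumed only inside the interval, where a solution of the problem is known to be
    differentiable. Each of the two integrations yields a constant, read off at the midpoint
    [g / 2]. *)
Lemma similarity_ode_solutions (T T1 T2 : R -> R) (g : R) :
  0 < g ->
  (forall x, 0 < x < g -> is_derive T x (T1 x)) ->
  (forall x, 0 < x < g -> is_derive T1 x (T2 x)) ->
  (forall x, 0 < x < g -> T2 x = 2 * (T x - x * T1 x)) ->
  exists a b, forall x, 0 < x < g -> T x = profile a b x.
Proof.
intros Hg D1 D2 E.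
assert (Hm : 0 < g / 2 < g) by lra.
(* The integrating factor [exp (x ^ 2)] makes this quantity constant. *)
set (u := fun x => (T x - x * T1 x) * exp (x ^ 2)).
assert (Hu : forall x, 0 < x < g -> T x - x * T1 x = u (g / 2) * exp (- (x ^ 2))).
{ intros x Hx.
  rewrite <- (constant_of_zero_derive u 0 g) with (x := x); try easy.
  - unfold u; rewrite Rmult_assoc, <- exp_plus, Rplus_opp_r, exp_0; ring.
  - intros y Hy; unfold u; auto_derive.
    + repeat split; [exists (T1 y); auto | exists (T2 y); auto].
    + rewrite (is_derive_unique (fun x0 : R => T x0) _ _ (D1 y Hy)).
      rewrite (is_derive_unique (fun x0 : R => T1 x0) _ _ (D2 y Hy)).
      rewrite (E y Hy); ring. }
set (a := u (g / 2)) in Hu.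
(* The remainder [G = T - profile a 0] satisfies [G = x G'], so [G / x] is constant. *)
set (q := fun x => (T x - profile a 0 x) / x).
exists a, (q (g / 2)); intros x Hx.
rewrite <- (constant_of_zero_derive q 0 g) with (x := x); try easy.
- unfold q, profile; field; lra.
- intros y Hy; unfold q; auto_derive.
  + repeat split; [exists (T1 y); auto | | lra].
    exists (a * sqrt PI * erf y + 0); apply is_derive_profile.
  + rewrite (is_derive_unique (fun x0 : R => T x0) _ _ (D1 y Hy)).
    rewrite (is_derive_unique (fun x0 : R => profile a 0 x0) _ _
               (is_derive_profile a 0 y)).
    replace (T y) with (y * T1 y + a * exp (- (y ^ 2)))
      by (rewrite <- (Hu y Hy); ring).
    unfold profile; field; lra.
Qed.

(** * One-sided derivatives and limits at the boundary *)

Lemma is_derive_left (f : R -> R) (x l : R) :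
  is_derive f x l -> is_left_derive f x l.
Proof.
intros H; apply is_derive_Reals in H.
apply filterlim_locally; intros eps.
destruct (H eps (cond_pos eps)) as [d Hd].
exists d; intros y By Hy.
assert (Hyx : y - x <> 0) by lra.
specialize (Hd (y - x) Hyx By).
rewrite Rplus_minus in Hd.
exact Hd.
Qed.

(** Limits along [at_left x] are unique. Agreement at [x] itself matters, since the difference
    quotient contains that value. *)
Lemma is_left_derive_unique (f g : R -> R) (c x l m : R) :
  c < x -> (forall y, c < y <= x -> f y = g y) ->
  is_left_derive f x l -> is_left_derive g x m -> l = m.
Proof.
intros Hc E Hf Hg.
apply (filterlim_locally_unique (F := at_left x)
         (fun y => (g y - g x) / (y - x))); [ | exact Hg].
apply filterlim_ext_loc with (2 := Hf).
assert (P : 0 < x - c) by lra.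
exists (mkposreal _ P); intros y By Hy.
change (Rabs (y - x) < x - c) in By; apply Rabs_def2 in By.
rewrite !E by lra; reflexivity.
Qed.

(** Carries an identity from the interior to an endpoint: [f] needs a limit only along [F], later a
    one-sided filter. *)
Lemma continuous_at_end_unique (F : (R -> Prop) -> Prop) {PF : ProperFilter F}
  (f g : R -> R) (x : R) :
  filterlim f F (locally (f x)) -> F (fun y => f y = g y) ->
  filter_le F (locally x) -> continuous g x -> f x = g x.
Proof.
intros Hf E Hx Hg.
apply (filterlim_locally_unique (F := F) g).
- exact (filterlim_ext_loc _ _ E Hf).
- exact (filterlim_filter_le_1 _ Hx Hg).
Qed.

(** Freezing time turns joint continuity on the closed region into one-sided continuity in space,
    once [F] is concentrated on the slice. *)
Lemma closed_slice_continuous (s : R -> R) (w : R -> R -> R) (t x : R)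
  (F : (R -> Prop) -> Prop) {FF : Filter F} :
  continuous_on (closed_region s) (fun p : R * R => w (fst p) (snd p)) ->
  closed_region s (x, t) -> filter_le F (locally x) ->
  F (fun y => closed_region s (y, t)) ->
  filterlim (fun y => w y t) F (locally (w x t)).
Proof.
intros C Hx HF HD.
apply (filterlim_comp _ _ _ (fun y => (y, t))
         (fun p : R * R => w (fst p) (snd p)) _
         (within (closed_region s) (locally (x, t)))); [ | exact (C _ Hx)].
intros P [d Hd]; unfold filtermap.
generalize (filter_and _ _ HD (HF _ (locally_ball x d))).
apply filter_imp; intros y [Dy By].
apply Hd; [ | exact Dy].
split; [exact By | apply ball_center].
Qed.

(** * Calculus of the free boundary and of similarity functions *)

Lemma is_derive_free_boundary (s : R -> R) (g t : R) :
  (forall r, 0 < r -> s r = 2 * g * sqrt r) -> 0 < t ->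
  is_derive s t (g / sqrt t).
Proof.
intros Hs Ht.
apply (is_derive_ext_loc (fun r => 2 * g * sqrt r)).
- exists (mkposreal t Ht); intros r Br; symmetry; apply Hs.
  change (Rabs (r - t) < t) in Br; apply Rabs_def2 in Br; lra.
- pose proof (sqrt_lt_R0 t Ht); auto_derive; [easy | field; lra].
Qed.

Lemma is_derive_similarity_z (T T1 : R -> R) (z t : R) :
  0 < t -> (forall x, is_derive T x (T1 x)) ->
  is_derive (fun y => 2 * sqrt t * T (y / (2 * sqrt t))) z
    (T1 (z / (2 * sqrt t))).
Proof.
intros Ht H; pose proof (sqrt_lt_R0 t Ht).
auto_derive.
- repeat split; eexists; apply H.
- rewrite (is_derive_unique (fun x0 : R => T x0) _ _ (H _)).
  unfold Rdiv; field; lra.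
Qed.

Lemma is_derive_similarity_zz (T1 T2 : R -> R) (z t : R) :
  0 < t -> (forall x, is_derive T1 x (T2 x)) ->
  is_derive (fun y => T1 (y / (2 * sqrt t))) z
    (T2 (z / (2 * sqrt t)) / (2 * sqrt t)).
Proof.
intros Ht H; pose proof (sqrt_lt_R0 t Ht).
auto_derive.
- repeat split; eexists; apply H.
- rewrite (is_derive_unique (fun x0 : R => T1 x0) _ _ (H _)).
  unfold Rdiv; field; lra.
Qed.

(** Differentiability of [T] is asked at one point only, so that the lemma also applies to a slice
    of an arbitrary solution, regular only inside the region. *)
Lemma is_derive_similarity_t (T : R -> R) (z t l : R) :
  0 < t -> is_derive T (z / (2 * sqrt t)) l ->
  is_derive (fun r => 2 * sqrt r * T (z / (2 * sqrt r))) t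
    ((T (z / (2 * sqrt t)) - z / (2 * sqrt t) * l) / sqrt t).
Proof.
intros Ht H; pose proof (sqrt_lt_R0 t Ht) as Hs; unfold Rdiv in H |- *.
auto_derive.
- repeat split; try lra; eexists; apply H.
- rewrite (is_derive_unique (fun x0 : R => T x0) _ _ H).
  field; lra.
Qed.

(** Common shape of [w] and its derivatives: [k y] is [2 * y] for [w], [1] for [w_z], and
    [/ (2 * y)] for [w_t] and [w_zz]. *)
Lemma continuous_similarity (f : R -> R) (k : R -> R) (p : R * R) :
  0 < snd p -> (forall x, continuous f x) -> continuous k (sqrt (snd p)) ->
  continuous (fun q : R * R => k (sqrt (snd q)) * f (fst q / (2 * sqrt (snd q)))) p.
Proof.
intros Hp Hf Hk.
pose proof (sqrt_lt_R0 _ Hp).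
assert (Hs : continuous (fun q : R * R => sqrt (snd q)) p).
{ apply (continuous_comp snd sqrt); [apply continuous_snd | apply continuous_sqrt]. }
apply (continuous_mult (K := R_AbsRing)).
- exact (continuous_comp (fun q : R * R => sqrt (snd q)) k p Hs Hk).
- apply (continuous_comp (fun q : R * R => fst q / (2 * sqrt (snd q))) f);
    [ | apply Hf].
  apply (continuous_mult (K := R_AbsRing)); [apply continuous_fst | ].
  apply (continuous_comp (fun q : R * R => sqrt (snd q)) (fun x => / (2 * x)));
    [exact Hs | ].
  apply (ex_derive_continuous (fun x => / (2 * x))); auto_derive; lra.
Qed.

Lemma continuous_on_similarity (D : R * R -> Prop) (f k : R -> R)
  (h : R * R -> R) :
  (forall p, D p -> 0 < snd p) -> (forall x, continuous f x) ->
  (forall x, 0 < x -> continuous k x) ->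
  (forall p, D p -> h p = k (sqrt (snd p)) * f (fst p / (2 * sqrt (snd p)))) ->
  continuous_on D h.
Proof.
intros HD Hf Hk E.
apply (continuous_on_ext D
  (fun q : R * R => k (sqrt (snd q)) * f (fst q / (2 * sqrt (snd q))))).
- intros p Dp; symmetry; exact (E p Dp).
- apply continuous_on_forall; intros p Dp.
  apply continuous_similarity; auto using sqrt_lt_R0.
Qed.

(** * Existence: from a profile to a solution *)

Definition similarity_w (T : R -> R) (z t : R) : R :=
  2 * sqrt t * T (z / (2 * sqrt t)).

(** The powers of [t] cancel in every condition: the front sits at similarity variable [g], and its
    speed [g / sqrt t] turns the prescribed flux into the constant [- L0 * g]. *)
Lemma similarity_w_is_solution (L0 v0 wm0 g : R) (T T1 T2 : R -> R) :
  0 < g ->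
  (forall x, is_derive T x (T1 x)) ->
  (forall x, is_derive T1 x (T2 x)) ->
  (forall x, continuous T2 x) ->
  (forall x, T2 x = 2 * (T x - x * T1 x)) ->
  T 0 = v0 -> T g = wm0 -> T1 g = - L0 * g ->
  is_similarity_solution L0 v0 wm0 (similarity_w T) (fun t => 2 * g * sqrt t).
Proof.
intros Hg D1 D2 C2 E T_0 T_g T1_g.
assert (C0 : forall x, continuous T x)
  by (intros x; apply (ex_derive_continuous T); eexists; apply D1).
assert (C1 : forall x, continuous T1 x)
  by (intros x; apply (ex_derive_continuous T1); eexists; apply D2).
assert (Wz : forall z t, 0 < t ->
  is_derive (fun y => similarity_w T y t) z (T1 (z / (2 * sqrt t))))
  by (intros; apply is_derive_similarity_z; easy).
assert (Wzz : forall z t, 0 < t ->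
  is_derive (Derive (fun y => similarity_w T y t)) z
    (T2 (z / (2 * sqrt t)) / (2 * sqrt t))).
{ intros z t Ht; apply (is_derive_ext (fun y => T1 (y / (2 * sqrt t)))).
  - intros y; symmetry; apply is_derive_unique, Wz, Ht.
  - apply is_derive_similarity_zz; easy. }
(* The equation for [T] gives the time derivative the same expression as the second space
   derivative; this is the heat equation. *)
assert (Wt : forall z t, 0 < t ->
  is_derive (fun r => similarity_w T z r) t
    (T2 (z / (2 * sqrt t)) / (2 * sqrt t))).
{ intros z t Ht; pose proof (sqrt_lt_R0 t Ht); rewrite E.
  replace (2 * _ / (2 * sqrt t)) with
    ((T (z / (2 * sqrt t)) - z / (2 * sqrt t) * T1 (z / (2 * sqrt t))) / sqrt t)
    by (field; lra).
  apply is_derive_similarity_t; easy. }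
assert (K2 : forall x, 0 < x -> continuous (fun y => / (2 * y)) x)
  by (intros x Hx; apply (ex_derive_continuous (fun y => / (2 * y)));
      auto_derive; lra).
assert (Kw : forall x, 0 < x -> continuous (fun y => 2 * y) x)
  by (intros x Hx; apply (ex_derive_continuous (fun y => 2 * y));
      auto_derive; easy).
assert (K1 : forall x, 0 < x -> continuous (fun _ : R => 1) x)
  by (intros; apply continuous_const).
assert (Bdry : forall t, 0 < t -> 2 * g * sqrt t / (2 * sqrt t) = g)
  by (intros t Ht; pose proof (sqrt_lt_R0 t Ht); field; lra).
split; [split; [ | split; [ | split; [ | split; [ | split; [ | split]]]]] | ].
- split; [ | split; [ | split; [ | split]]].
  + intros z t [Ht _]; simpl in Ht; repeat split.
    * eexists; apply Wz, Ht.
    * eexists; apply Wzz, Ht.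
    * eexists; apply Wt, Ht.
  + apply (continuous_on_similarity _ T (fun y => 2 * y)); auto.
    intros p Dp; apply Dp.
  + apply (continuous_on_similarity _ T1 (fun _ => 1)); auto.
    * intros p Dp; apply Dp.
    * intros p Dp; rewrite Rmult_1_l; apply is_derive_unique, Wz, Dp.
  + apply (continuous_on_similarity _ T2 (fun y => / (2 * y))); auto.
    * intros p Dp; apply Dp.
    * intros p Dp; rewrite Rmult_comm; apply is_derive_unique, Wt, Dp.
  + apply (continuous_on_similarity _ T2 (fun y => / (2 * y))); auto.
    * intros p Dp; apply Dp.
    * intros p Dp; rewrite Rmult_comm; apply is_derive_unique, Wzz, Dp.
- apply (continuous_on_similarity _ T (fun y => 2 * y)); auto.
  intros p Dp; apply Dp.
- intros z t [Ht _]; simpl in Ht.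
  transitivity (T2 (z / (2 * sqrt t)) / (2 * sqrt t));
    [apply is_derive_unique, Wzz, Ht | symmetry; apply is_derive_unique, Wt, Ht].
- intros t Ht; pose proof (sqrt_lt_R0 t Ht).
  assert (Ds := is_derive_free_boundary (fun t => 2 * g * sqrt t) g t
                  (fun _ _ => eq_refl) Ht).
  split; [eexists; exact Ds | ].
  rewrite (is_derive_unique _ _ _ Ds).
  replace (- L0 * sqrt t * (g / sqrt t)) with (T1 g) by (rewrite T1_g; field; lra).
  (* Since [T] is differentiable on the whole line, a two-sided derivative exists even at the
     front. *)
  apply is_derive_left; rewrite <- (Bdry t Ht) at 2; apply Wz, Ht.
- intros t Ht; unfold similarity_w; rewrite Bdry, T_g by easy; ring.
- intros t Ht; unfold similarity_w; unfold Rdiv; rewrite Rmult_0_l, T_0; ring.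
- rewrite sqrt_0; ring.
- exists T, g; repeat split; easy.
Qed.

(** * Uniqueness: every similarity solution comes from a profile *)

Lemma sqrt_quarter : sqrt (/ 4) = / 2.
Proof.
replace (/ 4) with ((/ 2) ^ 2) by field; apply sqrt_pow2; lra.
Qed.

(* At [t = 1/4] one has [2 sqrt t = 1], so that the slice [w(., 1/4)] is itself
   the profile [T]. *)
Lemma similarity_solution_profile (L0 v0 wm0 : R) (w : R -> R -> R) (s : R -> R) :
  is_similarity_solution L0 v0 wm0 w s ->
  exists b g, 0 < g /\
    (forall t, 0 <= t -> s t = 2 * g * sqrt t) /\
    (forall z t, closed_region s (z, t) -> w z t = similarity_w (profile v0 b) z t) /\
    profile v0 b g = wm0 /\
    v0 * sqrt PI * erf g + b = - L0 * g.
Proof.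
intros [[[Reg _] [Cl [Heat [Flux [Wg [W0 s_0]]]]]] [T [g [Hg [Hs HT]]]]].
assert (H4 : 0 < / 4) by lra.
assert (s4 : s (/ 4) = g) by (rewrite Hs, sqrt_quarter by lra; field).
set (W := fun y => w y (/ 4)).
assert (TW : forall x, 0 <= x <= g -> T x = W x).
{ intros x Hx; unfold W; rewrite HT.
  - rewrite sqrt_quarter; replace (x / (2 * / 2)) with x by field; field.
  - split; simpl; [lra | rewrite s4; lra]. }
assert (In4 : forall x, 0 < x < g -> open_region s (x, / 4))
  by (intros x Hx; split; simpl; [lra | rewrite s4; lra]).
assert (In4c : forall x, 0 <= x <= g -> closed_region s (x, / 4))
  by (intros x Hx; split; simpl; [lra | rewrite s4; lra]).
(* No regularity of [T] is assumed, whereas [W] inherits that of [w]; the similarity variable stays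
   in [[0, g]], where the two agree. *)
assert (wW : forall z t, closed_region s (z, t) -> w z t = similarity_w W z t).
{ intros z t Dp; rewrite (HT z t Dp); unfold similarity_w; rewrite TW; [easy | ].
  destruct Dp as [Ht Hz]; simpl in Ht, Hz; rewrite Hs in Hz by easy.
  pose proof (sqrt_lt_R0 t Ht); split.
  - apply Rdiv_le_0_compat; lra.
  - apply Rle_div_l; lra. }
assert (D1 : forall x, 0 < x < g -> is_derive W x (Derive W x))
  by (intros x Hx; apply Derive_correct, (Reg _ _ (In4 x Hx))).
assert (D2 : forall x, 0 < x < g -> is_derive (Derive W) x (Derive (Derive W) x))
  by (intros x Hx; apply Derive_correct, (Reg _ _ (In4 x Hx))).
assert (E : forall x, 0 < x < g ->
  Derive (Derive W) x = 2 * (W x - x * Derive W x)).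
{ intros x Hx.
  transitivity (w_t w x (/ 4)); [apply (Heat _ _ (In4 x Hx)) | ].
  unfold w_t; apply is_derive_unique.
  apply (is_derive_ext_loc (fun r => 2 * sqrt r * W (x / (2 * sqrt r)))).
  (* The similarity form holds only up to the front, so differentiating it in time requires [x] to
     stay behind the front at nearby times; continuity of [s] ensures this. *)
  - assert (Cs : continuous s (/ 4))
      by (apply (ex_derive_continuous s), (Flux _ H4)).
    assert (P : locally (s (/ 4)) (fun y => x < y))
      by (apply (open_gt x); rewrite s4; lra).
    assert (Q : locally (/ 4) (fun r => x < s r)) by exact (Cs _ P).
    generalize (filter_and _ _ Q (open_gt 0 (/ 4) H4)).
    apply filter_imp; intros r [Hr Hr0]; symmetry; apply wW.
    split; simpl; lra.
  - assert (Hx1 : x / (2 * sqrt (/ 4)) = x) by (rewrite sqrt_quarter; field).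
    pose proof (is_derive_similarity_t W x (/ 4) (Derive W x) H4) as K.
    rewrite Hx1, sqrt_quarter in K.
    replace (2 * (W x - x * Derive W x)) with ((W x - x * Derive W x) / / 2)
      by field.
    apply K, D1, Hx. }
destruct (similarity_ode_solutions W _ _ g Hg D1 D2 E) as [a [b Hab]].
assert (Cp : forall a b x, continuous (profile a b) x)
  by (intros; apply (ex_derive_continuous (profile _ _)); eexists;
      apply is_derive_profile).
assert (AtR : at_right 0 (fun y => 0 < y < g)).
{ exists (mkposreal g Hg); intros y By Hy.
  change (Rabs (y - 0) < g) in By; apply Rabs_def2 in By; lra. }
assert (AtL : at_left g (fun y => 0 < y < g)).
{ exists (mkposreal g Hg); intros y By Hy.
  change (Rabs (y - g) < g) in By; apply Rabs_def2 in By; lra. }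
(* The differential equation identifies [W] only in the interior; continuity on the closed region
   reaches both ends. *)
assert (W_0 : W 0 = profile a b 0).
{ apply (continuous_at_end_unique (at_right 0)).
  - apply (closed_slice_continuous s w (/ 4) 0 (at_right 0)); try easy.
    + apply In4c; lra.
    + apply filter_le_within.
    + revert AtR; apply filter_imp; intros y Hy; apply In4c; lra.
  - revert AtR; apply filter_imp; auto.
  - apply filter_le_within.
  - apply Cp. }
assert (W_g : W g = profile a b g).
{ apply (continuous_at_end_unique (at_left g)).
  - apply (closed_slice_continuous s w (/ 4) g (at_left g)); try easy.
    + apply In4c; lra.
    + apply filter_le_within.
    + revert AtL; apply filter_imp; intros y Hy; apply In4c; lra.
  - revert AtL; apply filter_imp; auto.
  - apply filter_le_within.
  - apply Cp. }
assert (Ha : a = v0).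
{ rewrite <- (profile_0 a b), <- W_0; unfold W; rewrite W0, sqrt_quarter by lra.
  field. }
subst a.
assert (Wp : forall x, 0 <= x <= g -> W x = profile v0 b x).
{ intros x [[Hx | <-] [Hx' | ->]]; auto. }
exists b, g; split; [easy | split; [ | split; [ | split]]].
(* At [t = 0] the similarity form says nothing; the initial condition on [s] supplies the value. *)
- intros t [Ht | <-]; [auto | rewrite s_0, sqrt_0; ring].
- intros z t Dp; rewrite (wW z t Dp); unfold similarity_w; rewrite Wp; [easy | ].
  destruct Dp as [Ht Hz]; simpl in Ht, Hz; rewrite Hs in Hz by easy.
  pose proof (sqrt_lt_R0 t Ht); split.
  + apply Rdiv_le_0_compat; lra.
  + apply Rle_div_l; lra.
- rewrite <- W_g; unfold W; rewrite <- s4, Wg, sqrt_quarter by lra; field.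
(* The left derivative of [W] at [g] is computed twice: from the flux condition, and from the
   profile with which [W] coincides up to [g]. *)
- destruct (Flux _ H4) as [_ FL].
  rewrite (is_derive_unique _ _ _ (is_derive_free_boundary s g _ Hs H4)) in FL.
  rewrite s4, sqrt_quarter in FL.
  replace (- L0 * / 2 * (g / / 2)) with (- L0 * g) in FL by field.
  symmetry.
  apply (is_left_derive_unique W (profile v0 b) 0 g); try easy.
  + intros y Hy; apply Wp; lra.
  + apply is_derive_left, is_derive_profile.
Qed.

(** * The equation for the front coefficient *)

Lemma front_equation_unique (L0 v0 wm0 g h : R) :
  0 < L0 -> 0 < v0 -> 0 < g -> 0 < h ->
  v0 * exp (- (g ^ 2)) = L0 * g ^ 2 + wm0 ->
  v0 * exp (- (h ^ 2)) = L0 * h ^ 2 + wm0 -> g = h.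
Proof.
intros HL Hv.
assert (M : forall x y, 0 < x -> x < y ->
  v0 * exp (- (x ^ 2)) = L0 * x ^ 2 + wm0 ->
  v0 * exp (- (y ^ 2)) = L0 * y ^ 2 + wm0 -> False).
{ intros x y Hx Hxy Ex Ey.
  assert (Q : x ^ 2 < y ^ 2) by nra.
  assert (K : exp (- (y ^ 2)) < exp (- (x ^ 2))) by (apply exp_increasing; lra).
  apply (Rmult_lt_compat_l v0) in K; [ | easy].
  apply (Rmult_lt_compat_l L0) in Q; [lra | easy]. }
intros Hg Hh Eg Eh.
destruct (Rtotal_order g h) as [L | [L | L]]; [ | easy | ]; exfalso; eauto.
Qed.

(** Intermediate values for the right side minus the left: at [0] it is [wm0 - v0 < 0], and it is
    positive once [L0 * x ^ 2] reaches [v0], which dictates the endpoint [X]. *)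
Lemma front_equation_solvable (L0 v0 wm0 : R) :
  0 < L0 -> 0 < v0 -> 0 < wm0 -> wm0 < v0 ->
  exists g, 0 < g /\ v0 * exp (- (g ^ 2)) = L0 * g ^ 2 + wm0.
Proof.
intros HL Hv Hw Hwv.
set (f := fun x => L0 * x ^ 2 + wm0 - v0 * exp (- (x ^ 2))).
assert (Cf : continuity f).
{ intros x; apply derivable_continuous_pt, ex_derive_Reals_0.
  unfold f; auto_derive; easy. }
set (X := sqrt (v0 / L0)).
assert (HX : 0 < X) by (apply sqrt_lt_R0, Rdiv_lt_0_compat; easy).
assert (HX2 : L0 * X ^ 2 = v0).
{ unfold X; rewrite pow2_sqrt by (apply Rdiv_le_0_compat; lra); field; lra. }
assert (f0 : f 0 < 0).
{ unfold f; replace (- 0 ^ 2) with 0 by ring; rewrite exp_0; lra. }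
assert (fX : 0 < f X).
{ unfold f; rewrite HX2.
  assert (exp (- X ^ 2) < 1) by (rewrite <- exp_0; apply exp_increasing; nra).
  nra. }
destruct (IVT f 0 X Cf HX f0 fX) as [g [Hg Eg]].
exists g; split.
(* The root lies in a closed interval; [f 0 < 0] excludes the end [0]. *)
- destruct Hg as [[Hg | <-] _]; lra.
- unfold f in Eg; lra.
Qed.

Theorem theorem3p1 :
  forall L0 v0 wm0 : R,
    0 < L0 -> 0 < v0 -> 0 < wm0 -> wm0 < v0 ->
    exists gs : R,
      unique
        (fun gamma : R =>
           0 < gamma /\ v0 * exp (- (gamma ^ 2)) = L0 * gamma ^ 2 + wm0) gs /\
      exists (w : R -> R -> R) (s : R -> R),
        is_similarity_solution L0 v0 wm0 w s /\
        (forall (w' : R -> R -> R) (s' : R -> R),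
           is_similarity_solution L0 v0 wm0 w' s' -> same_pair w s w' s') /\
        (forall z t : R, 0 < t -> 0 <= z <= s t ->
           w z t = 2 * v0 * sqrt t * exp (- (z ^ 2 / (4 * t)))
                   + v0 * z * sqrt PI * erf (z / (2 * sqrt t))
                   - L0 * z * gs
                   - v0 * z * sqrt PI * erf gs) /\
        (forall t : R, 0 < t -> s t = 2 * gs * sqrt t).
Proof.
intros L0 v0 wm0 HL Hv Hw Hwv.
destruct (front_equation_solvable L0 v0 wm0) as [g [Hg Eg]]; try easy.
exists g; split.
{ split; [easy | ]; intros h [Hh Eh].
  apply (front_equation_unique L0 v0 wm0); easy. }
(* The slope forced by the flux condition [v0 * sqrt PI * erf g + b = - L0 * g]. *)
set (b := - L0 * g - v0 * sqrt PI * erf g).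
exists (similarity_w (profile v0 b)), (fun t => 2 * g * sqrt t).
split; [ | split; [ | split]].
- apply (similarity_w_is_solution L0 v0 wm0 g _
    (fun x => v0 * sqrt PI * erf x + b) (fun x => 2 * v0 * exp (- (x ^ 2))));
    try easy.
  + apply is_derive_profile.
  + apply is_derive_profile'.
  + intros x; apply (ex_derive_continuous (fun x => 2 * v0 * exp (- (x ^ 2)))).
    auto_derive; easy.
  + intros x; unfold profile; ring.
  + apply profile_0.
  (* The [erf] terms cancel at [g], leaving exactly the front equation. *)
  + unfold profile, b; lra.
  + unfold b; ring.
- intros w' s' H.
  destruct (similarity_solution_profile _ _ _ _ _ H)
    as [b' [g' [Hg' [Es [Ew [E1 E2]]]]]].
  (* Subtracting [g'] times the flux relation from the value at the front eliminates both [b'] and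
     [erf g'], so [g'] solves the same front equation. *)
  assert (Eg' : g' = g).
  { apply (front_equation_unique L0 v0 wm0); try easy.
    rewrite <- E1; replace (L0 * g' ^ 2) with (- g' * (- L0 * g')) by ring.
    rewrite <- E2; unfold profile; ring. }
  subst g'.
  assert (Eb : b' = b) by (unfold b; lra).
  subst b'.
  split.
  + intros t Ht; rewrite Es; easy.
  + intros z t [Ht Hz]; simpl in Ht, Hz; symmetry; apply Ew.
    split; simpl; [easy | rewrite Es by lra; easy].
- intros z t Ht _; pose proof (sqrt_lt_R0 t Ht).
  unfold similarity_w, profile, b.
  replace (z ^ 2 / (4 * t)) with ((z / (2 * sqrt t)) ^ 2).
  + field; lra.
  + rewrite <- (sqrt_sqrt t) at 2 by lra; field; lra.
- easy.
Qed.
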